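(* Let $n, T \ge 1$ be integers and let $p = M(n)/n^2$. If $V = T^{-1}\,\mathbb{E}\left((\nu^{-1}-p)^2\right)$ is the variance of the estimate $E = T^{-1}\sum_{1 \le j \le T} 1/\nu_j$ of $M(n)/n^2$ after $T$ trials of the product algorithm (described in the context), then $$V \le \frac{p(1-p)}{T}.$$
   Context: $M(n) := |\{ij : 1 \le i,j \le n\}|$ is the number of distinct entries in the $n\times n$ multiplication table. Product algorithm: each trial takes $z = xy$, where $x$ and $y$ are independent and uniformly distributed integers in $[1,n]$. Let $\nu = \nu(z) \ge 1$ be the number of times that $z$ appears in the $n\times n$ multiplication table, i.e. the number of ordered pairs $(a,b)$ with $1 \le a,b \le n$ and $ab = z$. A sequence of $T$ independent trials gives values $\nu_1,\ldots,\nu_T$ of $\nu$, and the estimate of $M(n)/n^2$ produced is $E := T^{-1}\sum_{1\le j\le T} 1/\nu_j$. Here $\mathbb{E}$ denotes expectation. *)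

(* Defs.v *)
From HB Require Import structures.
From mathcomp Require Export all_boot all_order all_algebra.
From mathcomp Require Export all_classical all_reals all_analysis.

Set Implicit Arguments.
Unset Strict Implicit.
Unset Printing Implicit Defensive.

Import Order.TTheory GRing.Theory Num.Theory.
Import numFieldNormedType.Exports.

Local Open Scope classical_set_scope.
Local Open Scope ring_scope.

(* All n ^ 2 entries, listed with repetitions. *)
Definition mult_table (n : nat) : seq nat :=
  [seq (a * b)%N | a <- iota 1 n, b <- iota 1 n].

Definition M (n : nat) : nat := size (undup (mult_table n)).

Definition nu (n z : nat) : nat := count_mem z (mult_table n).

Definition uniform_upto (d : measure_display) (Omega : measurableType d)
    (R : realType) (P : probability Omega R) (n : nat) (X : {RV P >-> nat}) :
    Prop :=
  forall k : nat, (1 <= k <= n)%N -> distribution P X [set k] = (n%:R^-1)%:E.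

(* The product rule is required for every finite subfamily J. *)
Definition mutually_independent (d d' : measure_display)
    (Omega : measurableType d) (S : measurableType d') (R : realType)
    (P : probability Omega R) (I : finType) (X : I -> {RV P >-> S}) : Prop :=
  forall (J : {set I}) (B : I -> set S),
    (forall i, measurable (B i)) ->
    P (\bigcap_(i in [set` J]) (X i @^-1` B i)) =
    (\prod_(i in J) P (X i @^-1` B i))%E.

(* T independent trials: the j-th one draws x j and y j.  Independence of the
   trials, and of x j and y j inside each trial, amounts to mutual independence
   of all 2 * T draws. *)
Record product_algorithm (d : measure_display) (Omega : measurableType d)
    (R : realType) (P : probability Omega R) (n T : nat)
    (x y : 'I_T -> {RV P >-> nat}) : Prop := {
  uniform_x : forall j, uniform_upto n (x j);
  uniform_y : forall j, uniform_upto n (y j);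
  indep_draws : mutually_independent
    (fun i : 'I_T + 'I_T => match i with inl j => x j | inr j => y j end)
}.

(* 1 / nu_j.  The junk value 0^-1 = 0 can only occur when x j or y j leaves
   [1, n], which has probability 0. *)
Definition inv_nu (d : measure_display) (Omega : measurableType d)
    (R : realType) (P : probability Omega R) (n T : nat)
    (x y : 'I_T -> {RV P >-> nat}) (j : 'I_T) (w : Omega) : R :=
  (nu n (x j w * y j w)%N)%:R^-1.

Definition estimate (d : measure_display) (Omega : measurableType d)
    (R : realType) (P : probability Omega R) (n T : nat)
    (x y : 'I_T -> {RV P >-> nat}) (w : Omega) : R :=
  T%:R^-1 * \sum_(j < T) inv_nu n x y j w.

(* Main.v *)
Require Import Defs.
From mathcomp Require Import all_boot all_order all_algebra.
From mathcomp Require Import all_classical all_reals all_analysis.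
From mathcomp Require Import measurable_realfun ring lra.

(** Only the outcomes of the [2 T] draws matter, and these are finite in
    number.  Mutual independence and uniformity of the draws give every vector
    of [T] pairs in [1, n]^2 the probability [n^(-2T)] ([cell_prob]); these
    probabilities add up to 1, so the event that some draw leaves [1, n] is
    null and each expectation is the plain average, over all functions from
    the trials to [1, n]^2, of a function of the draws ([expectation_draws]).
    What remains is arithmetic of finite averages.

    Write [h (a, b) = 1 / nu (a b)].  A value occurring [k] times in the table
    contributes [k] terms [1/k] to the sum of [h], so the sum counts the
    distinct entries and the average of [h] is [p] ([avg_inv_nu]).  In the
    average of the squared deviation of the sample mean, the cross terms vanish
    because distinct coordinates of a vector decouple and [h - p] has average
    0; the [T] diagonal terms leave [1/T] times the variance of [h]
    ([avg_sample_variance]).  Finally [0 <= h <= 1] gives [h ^ 2 <= h], so this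
    variance, the average of [h ^ 2] minus [p ^ 2], is at most [p - p ^ 2]
    ([avg_sqr_dev_le]). *)

Set Implicit Arguments.
Unset Strict Implicit.
Unset Printing Implicit Defensive.

Import Order.TTheory GRing.Theory Num.Theory.

Local Open Scope ring_scope.

(** * Averages over finite types *)

Definition avg (R : realFieldType) (A : finType) (F : A -> R) : R :=
  (\sum_a F a) / #|A|%:R.

Lemma eq_avg (R : realFieldType) (A : finType) (F G : A -> R) :
  F =1 G -> avg F = avg G.
Proof. by move=> FG; congr (_ / _); apply: eq_bigr => a _; exact: FG. Qed.

Lemma avg_cst (R : realFieldType) (A : finType) (c : R) :
  (0 < #|A|)%N -> avg (fun _ : A => c) = c.
Proof.
move=> A0; rewrite /avg sumr_const -[_ *+ _]mulr_natr mulfK//.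
by rewrite pnatr_eq0 -lt0n.
Qed.

Lemma avgD (R : realFieldType) (A : finType) (F G : A -> R) :
  avg (fun a => F a + G a) = avg F + avg G.
Proof. by rewrite /avg big_split mulrDl. Qed.

Lemma avgZ (R : realFieldType) (A : finType) (c : R) (F : A -> R) :
  avg (fun a => c * F a) = c * avg F.
Proof. by rewrite /avg -mulr_sumr mulrA. Qed.

Lemma avg_sum (R : realFieldType) (A I : finType) (F : I -> A -> R) :
  avg (fun a => \sum_i F i a) = \sum_i avg (F i).
Proof. by rewrite /avg exchange_big mulr_suml. Qed.

(** Independence of the coordinates of a uniformly random vector, in finite
    form: expanding the product of sums runs over all functions [I -> C]. *)
Lemma avg_ffun_prod (R : realFieldType) (I C : finType) (F : I -> C -> R) :
  avg (fun g : {ffun I -> C} => \prod_i F i (g i)) = \prod_i avg (F i).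
Proof.
rewrite /avg -bigA_distr_bigA big_split/= prodr_const card_ffun; congr (_ * _).
by rewrite natrX exprVn.
Qed.

(** The marginal law of one coordinate: take the constant factor 1 at all other
    coordinates in [avg_ffun_prod]. *)
Lemma avg_ffun1 (R : realFieldType) (I C : finType) (h : C -> R) (i : I) :
  (0 < #|C|)%N -> avg (fun g : {ffun I -> C} => h (g i)) = avg h.
Proof.
move=> C0; pose F k c := if k == i then h c else 1.
transitivity (avg (fun g : {ffun I -> C} => \prod_k F k (g k))).
  apply: eq_avg => g; rewrite (bigD1 i)//= /F eqxx big1 ?mulr1// => k.
  by move/negPf => ->.
rewrite avg_ffun_prod (bigD1 i)//= big1 /F ?eqxx ?mulr1// => k /negPf ->.
exact: avg_cst.
Qed.

Lemma avg_ffun2 (R : realFieldType) (I C : finType) (h k : C -> R) (i j : I) :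
  (0 < #|C|)%N -> i != j ->
  avg (fun g : {ffun I -> C} => h (g i) * k (g j)) = avg h * avg k.
Proof.
move=> C0 ij; have ji : j != i by rewrite eq_sym.
pose F l c := if l == i then h c else if l == j then k c else 1.
transitivity (avg (fun g : {ffun I -> C} => \prod_l F l (g l))).
  apply: eq_avg => g; rewrite (bigD1 i)//= (bigD1 j)//= /F !eqxx (negPf ji).
  by rewrite big1 ?mulr1// => l /andP[/negPf -> /negPf ->].
rewrite avg_ffun_prod (bigD1 i)//= (bigD1 j)//= /F !eqxx (negPf ji).
rewrite big1 ?mulr1// => l /andP[/negPf -> /negPf ->].
exact: avg_cst.
Qed.

Lemma avg_sample_mean (R : realFieldType) (C : finType) (T : nat)
    (h : C -> R) : (0 < #|C|)%N -> (0 < T)%N ->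
  avg (fun g : {ffun 'I_T -> C} => T%:R^-1 * \sum_j h (g j)) = avg h.
Proof.
move=> C0 T0; rewrite avgZ avg_sum.
under eq_bigr => j _ do rewrite avg_ffun1//.
rewrite sumr_const card_ord -[avg h *+ _]mulr_natl mulKf//.
by rewrite pnatr_eq0 -lt0n.
Qed.

(** Expanding the square of the centred sum, all off-diagonal terms average to
    0 by [avg_ffun2], which leaves [T] equal diagonal terms against the factor
    [T^-2]. *)
Lemma avg_sample_variance (R : realFieldType) (C : finType) (T : nat)
    (h : C -> R) : (0 < #|C|)%N -> (0 < T)%N ->
  avg (fun g : {ffun 'I_T -> C} =>
         (T%:R^-1 * \sum_j h (g j) - avg h) ^+ 2) =
  T%:R^-1 * avg (fun c => (h c - avg h) ^+ 2).
Proof.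
move=> C0 T0; set m := avg h; pose w c := h c - m.
have T0R : T%:R != 0 :> R by rewrite pnatr_eq0 -lt0n.
have w0 : avg w = 0 by rewrite /w avgD avg_cst// subrr.
transitivity (avg (fun g : {ffun 'I_T -> C} =>
    T%:R^-1 ^+ 2 * \sum_i \sum_j w (g i) * w (g j))).
  apply: eq_avg => g; rewrite -[RHS]/(_ * _).
  under [in RHS]eq_bigr => i _ do rewrite -mulr_sumr.
  rewrite -mulr_suml -expr2 -exprMn; congr (_ ^+ 2).
  by rewrite /w sumrB sumr_const card_ord mulrBr -[m *+ T]mulr_natl mulKf.
rewrite avgZ avg_sum.
transitivity (T%:R^-1 ^+ 2 * \sum_(i < T) avg (fun c => w c ^+ 2)).
  congr (_ * _); apply: eq_bigr => i _.
  rewrite avg_sum (bigD1 i)//= big1 ?addr0 => [|j ji].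
    rewrite -(avg_ffun1 (fun c => w c ^+ 2) i)//.
  by rewrite avg_ffun2 1?eq_sym// w0 mul0r.
rewrite sumr_const card_ord -[avg _ *+ T]mulr_natl expr2 -mulrA.
by rewrite mulKf.
Qed.

(** A variable with values in [0, 1] has at most the variance of a Bernoulli
    variable with the same mean. *)
Lemma avg_sqr_dev_le (R : realFieldType) (C : finType) (h : C -> R) :
  (0 < #|C|)%N -> (forall c, 0 <= h c <= 1) ->
  avg (fun c => (h c - avg h) ^+ 2) <= avg h * (1 - avg h).
Proof.
move=> C0 h01; set m := avg h.
(* The right-hand side is averaged as well, so that the bound becomes
   pointwise: after cancellation it is [h c ^ 2 <= h c]. *)
have -> : m * (1 - m) = avg (fun c => (1 - 2 * m) * h c + m ^+ 2).
  by rewrite avgD avgZ avg_cst// -/m; ring.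
rewrite /avg ler_pM2r ?invr_gt0 ?ltr0n//; apply: ler_sum => c _.
have /andP[h0 h1] := h01 c; have := mulr_ge0 h0 (_ : 0 <= 1 - h c).
by rewrite subr_ge0 => /(_ h1); lra.
Qed.

(** * The average of the inverse multiplicity *)

Lemma sum_inv_count (R : realFieldType) (A : eqType) (s : seq A) :
  \sum_(z <- s) ((count_mem z s)%:R^-1 : R) = (size (undup s))%:R.
Proof.
rewrite -big_undup_iterop_count big_seq.
under eq_bigr => z zs.
  rewrite (_ : iterop _ _ _ _ = 1); first over.
  rewrite -[LHS]/(_ *+ _) -mulr_natl divff// pnatr_eq0 -lt0n.
  by rewrite -has_count has_pred1 -mem_undup.
by rewrite -big_seq big_const_seq count_predT iter_addr_0.
Qed.

Lemma avg_inv_nu (R : realType) (n : nat) :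
  avg (fun c : 'I_n * 'I_n => (nu n (c.1.+1 * c.2.+1)%N)%:R^-1) =
  (M n)%:R / n%:R ^+ 2 :> R.
Proof.
rewrite /avg card_prod card_ord natrM -expr2; congr (_ / _).
rewrite /M -sum_inv_count {1}/mult_table big_allpairs_dep.
have sum_iota (F : nat -> R) : \sum_(a <- iota 1 n) F a = \sum_(a < n) F a.+1.
  by rewrite (iotaDl 1 0) big_map -val_enum_ord big_map big_enum.
rewrite sum_iota; under [RHS]eq_bigr => a _ do rewrite sum_iota.
by rewrite pair_bigA.
Qed.

(** * Expectations of functions of the draws *)

(** The events [D a] exhaust the space only up to a null set, on which [Z] may
    take any values; this is why measurability of [Z] is assumed and does not
    follow from the values of [Z] on the [D a]. *)
Lemma expectation_equiprobable (d : measure_display) (Omega : measurableType d)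
    (R : realType) (P : probability Omega R) (A : finType)
    (D : A -> set Omega) (F : A -> R) (Z : Omega -> R) :
  (0 < #|A|)%N ->
  (forall a, measurable (D a)) -> trivIset setT D ->
  (forall a, P (D a) = (#|A|%:R^-1)%:E) ->
  measurable_fun setT Z -> (forall a w, D a w -> Z w = F a) ->
  'E_P[Z]%E = (avg F)%:E.
Proof.
move=> A0 mD tD PD mZ ZF.
have tD' : trivIset [set` index_enum A] D by apply: sub_trivIset tD.
pose U := \big[setU/set0]_(a <- index_enum A) D a.
have mU : measurable U by exact: bigsetU_measurable.
have int_cst (B : set Omega) (c : R) : measurable B ->
    (\int[P]_(w in B) c%:E)%E = (c%:E * P B)%E.
  by move=> mB; exact: (integral_cst P mB c%:E).
have PU : P U = 1%E.
  rewrite -[LHS]mul1e -int_cst// (integral_bigsetU_EFin P mD) ?index_enum_uniq//;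
    last exact: measurable_cst.
  under eq_bigr => a _ do rewrite int_cst// mul1e PD.
  rewrite sumEFin sumr_const -[_ *+ _]mulr_natl divff//.
  by rewrite pnatr_eq0 -lt0n.
have mZE : measurable_fun setT (EFin \o Z) by exact/measurable_EFinP.
have -> : 'E_P[Z]%E = (\int[P]_(w in U `|` ~` U) (Z w)%:E)%E.
  by rewrite unlock setUv.
rewrite integral_setU//; last 3 first.
- exact: measurableC.
- by rewrite setUv.
- by rewrite disj_set2E setICr.
rewrite [X in (_ + X)%E]null_set_integral ?adde0//; last 3 first.
- exact: measurableC.
- exact: measurable_funS mZE.
- transitivity (1 - P U)%E; first exact: probability_setC.
  by rewrite PU subee.
rewrite integral_bigsetU_EFin ?index_enum_uniq//; last first.
  exact: measurable_funS mZE.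
rewrite /avg mulr_suml -sumEFin; apply: eq_bigr => a _.
rewrite (eq_integral (fun=> (F a)%:E)) => [|w /set_mem/ZF ->//].
by rewrite int_cst// PD EFinM.
Qed.

(** Since [nat] is countable and discrete, the preimage of any set is a countable
    union of events fixing the value of [X]. *)
Lemma measurable_pair_nat (d : measure_display) (Omega : measurableType d)
    (R : realType) (P : probability Omega R) (X Y : {RV P >-> nat})
    (f : nat -> nat -> R) :
  measurable_fun setT (fun w => f (X w) (Y w)).
Proof.
move=> _ B mB; rewrite setTI.
have -> : ((fun w => f (X w) (Y w)) @^-1` B = 
    \bigcup_a (X @^-1` [set a] `&` Y @^-1` [set b | B (f a b)]))%classic.
  apply/seteqP; split => [w Bw|w [a _ [/= <-]]//].
  by exists (X w).
apply: bigcup_measurable => a _; apply: measurableI.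
  by rewrite -[X in measurable X]setTI; exact: measurable_funPT.
by rewrite -[X in measurable X]setTI; exact: measurable_funPT.
Qed.

(** The index [i : 'I_n] stands for the draw [i + 1], whence the successors. *)
Definition cell (d : measure_display) (Omega : measurableType d)
    (R : realType) (P : probability Omega R) (n T : nat)
    (x y : 'I_T -> {RV P >-> nat}) (g : {ffun 'I_T -> 'I_n * 'I_n}) :
    set Omega :=
  [set w | forall j, x j w = (g j).1.+1 /\ y j w = (g j).2.+1]%classic.

(** The form of the event to which mutual independence applies, for the full
    family of draws. *)
Lemma cellE (d : measure_display) (Omega : measurableType d)
    (R : realType) (P : probability Omega R) (n T : nat)
    (x y : 'I_T -> {RV P >-> nat}) (g : {ffun 'I_T -> 'I_n * 'I_n}) :
  let X (i : 'I_T + 'I_T) := match i with inl j => x j | inr j => y j end in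
  let v (i : 'I_T + 'I_T) :=
    match i with inl j => (g j).1.+1 | inr j => (g j).2.+1 end in
  cell x y g = (\bigcap_(i in [set` [set: 'I_T + 'I_T]%SET])
                  (X i @^-1` [set v i]))%classic.
Proof.
move=> X v; apply/seteqP; split => [w wg [j|j] _|w wg j].
- by have [] := wg j.
- by have [] := wg j.
- by split; [apply: (wg (inl j))|apply: (wg (inr j))]; rewrite /= inE.
Qed.

Lemma measurable_cell (d : measure_display) (Omega : measurableType d)
    (R : realType) (P : probability Omega R) (n T : nat)
    (x y : 'I_T -> {RV P >-> nat}) (g : {ffun 'I_T -> 'I_n * 'I_n}) :
  measurable (cell x y g).
Proof.
rewrite cellE; apply: fin_bigcap_measurable => // i _.
by rewrite -[X in measurable X]setTI; exact: measurable_funPT.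
Qed.

Lemma trivIset_cell (d : measure_display) (Omega : measurableType d)
    (R : realType) (P : probability Omega R) (n T : nat)
    (x y : 'I_T -> {RV P >-> nat}) :
  trivIset setT (fun g : {ffun 'I_T -> 'I_n * 'I_n} => cell x y g).
Proof.
move=> g1 g2 _ _ [w [w1 w2]]; apply/ffunP => j.
have [x1 y1] := w1 j; have [x2 y2] := w2 j.
move: x1 y1; rewrite x2 y2 => -[e1] [e2].
by case: (g1 j) (g2 j) e1 e2 => a b [a' b'] /= /val_inj -> /val_inj ->.
Qed.

Lemma cell_prob (d : measure_display) (Omega : measurableType d)
    (R : realType) (P : probability Omega R) (n T : nat)
    (x y : 'I_T -> {RV P >-> nat}) (g : {ffun 'I_T -> 'I_n * 'I_n}) :
  product_algorithm n x y ->
  P (cell x y g) = (#|{ffun 'I_T -> 'I_n * 'I_n}|%:R^-1)%:E.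
Proof.
case=> ux uy indep; rewrite cellE indep// (eq_bigr (fun=> (n%:R^-1)%:E)).
  rewrite prodEFin prodr_const cardsT card_sum card_ffun card_prod !card_ord.
  by rewrite natrX natrM -expr2 -exprM mul2n -addnn exprVn.
by move=> [j|j] _; [apply: (ux j)|apply: (uy j)]; exact: ltn_ord.
Qed.

(** The whole probabilistic content of the sampling scheme: expectations reduce
    to averages over all possible vectors of draws. *)
Lemma expectation_draws (d : measure_display) (Omega : measurableType d)
    (R : realType) (P : probability Omega R) (n T : nat)
    (x y : 'I_T -> {RV P >-> nat})
    (F : {ffun 'I_T -> 'I_n * 'I_n} -> R) (Z : Omega -> R) :
  (0 < n)%N -> product_algorithm n x y -> measurable_fun setT Z ->
  (forall g w, cell x y g w -> Z w = F g) -> 'E_P[Z]%E = (avg F)%:E.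
Proof.
move=> n0 hxy mZ ZF; apply: (expectation_equiprobable (D := cell x y)) => //.
- by rewrite card_ffun card_prod !card_ord expn_gt0 muln_gt0 n0.
- exact: measurable_cell.
- exact: trivIset_cell.
- by move=> g; exact: cell_prob.
Qed.

Theorem lemma3p2 (n T : nat) (hn : (1 <= n)%N) (hT : (1 <= T)%N)
    (d : measure_display) (Omega : measurableType d) (R : realType)
    (P : probability Omega R) (x y : 'I_T -> {RV P >-> nat})
    (hxy : product_algorithm n x y) (j : 'I_T) :
  let p : R := (M n)%:R / n%:R ^+ 2 in
  let V : \bar R :=
    ((T%:R^-1)%:E * 'E_P[fun w : Omega => ((inv_nu n x y j w - p) ^+ 2)%R])%E in
  ('V_P[estimate n x y] = V)%E /\ (V <= (p * (1 - p) / T%:R)%:E)%E.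
Proof.
move=> p V.
pose h (c : 'I_n * 'I_n) : R := (nu n (c.1.+1 * c.2.+1)%N)%:R^-1.
have C0 : (0 < #|{: 'I_n * 'I_n}|)%N by rewrite card_prod card_ord muln_gt0 hn.
have hp : avg h = p by exact: avg_inv_nu.
have h01 c : 0 <= h c <= 1.
  (* At [nu = 0] the inverse is 0, which also lies in the unit interval. *)
  rewrite /h invr_ge0 ler0n/=; case: (nu _ _) => [|k]; first by rewrite invr0.
  by rewrite invf_le1 ?ltr0n// ler1n.
have nuh g w i : cell x y g w -> inv_nu n x y i w = h (g i).
  by move=> /(_ i)[xg yg]; rewrite /inv_nu xg yg.
have mnu i : measurable_fun setT (inv_nu n x y i).
  exact: (measurable_pair_nat _ _ (fun a b => (nu n (a * b)%N)%:R^-1)).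
have mest : measurable_fun setT (estimate n x y).
  by apply: measurable_funM => //; exact: measurable_sum.
have esth g w : cell x y g w ->
    estimate n x y w = T%:R^-1 * \sum_i h (g i).
  by move=> wg; congr (_ * _); apply: eq_bigr => i _; exact: nuh.
have VE : V = (T%:R^-1 * avg (fun c => (h c - p) ^+ 2))%:E.
  rewrite /V EFinM; congr (_ * _)%E.
  rewrite -(avg_ffun1 (fun c => (h c - p) ^+ 2) j)//.
  apply: (expectation_draws hn hxy) => [|g w /nuh -> //].
  by apply: measurable_funX; exact: measurable_funB.
split.
  have Eest : 'E_P[estimate n x y]%E = p%:E.
    rewrite -hp -(avg_sample_mean h C0 hT).
    exact: (expectation_draws hn hxy).
  rewrite VE -hp -avg_sample_variance// hp /variance covariance.unlock Eest/=.
  apply: (expectation_draws hn hxy) => [|g w /esth eg].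
    by apply: measurable_funM; exact: measurable_funB.
  by rewrite -eg expr2.
rewrite VE lee_fin mulrC ler_pM2r ?invr_gt0 ?ltr0n// -hp.
exact: avg_sqr_dev_le.
Qed.
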